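(* For all integers $a\ge 3$ and all integers $k\ge 3$, $$R(a,k)\le 2^{\,R(a-2,k-1)^{a-1}\; 2^{\,R(a-2,k-1)^{a-2}}}.$$
   Context: For a set $X$ and an integer $a\ge 1$, $\binom{X}{a}$ denotes the set of all $a$-element subsets of $X$, and $[n]=\{1,\dots,n\}$. Given a coloring $COL$ of $\binom{[n]}{a}$, a set $H\subseteq[n]$ is $a$-homogeneous for $COL$ if all elements of $\binom{H}{a}$ have the same color (vacuously true if $|H|<a$); $a=1$ is allowed, in which case a coloring of $\binom{[n]}{1}$ is just a coloring of the points of $[n]$. For integers $a,k\ge 1$, $R(a,k)$ denotes the least $n$ such that for every 2-coloring of $\binom{[n]}{a}$ there exists an $a$-homogeneous set $H\subseteq [n]$ with $|H|=k$ (this number exists by Ramsey's theorem). *)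

(* Defs.v *)
From HB Require Import structures.
From mathcomp Require Import all_boot.
Set Implicit Arguments.
Unset Strict Implicit.
Unset Printing Implicit Defensive.

(* The ground set [n] = {1, ..., n} is represented by 'I_n. *)
Definition subsets (n a : nat) : Type := {A : {set 'I_n} | #|A| == a}.

HB.instance Definition _ (n a : nat) := Finite.on (subsets n a).

(* The two colors are the elements of bool. *)
Definition coloring (n a : nat) : Type := {ffun subsets n a -> bool}.

HB.instance Definition _ (n a : nat) := Finite.on (coloring n a).

Definition homogeneous (n a : nat) (c : coloring n a) (H : {set 'I_n}) : bool :=
  [forall A : subsets n a, forall B : subsets n a,
    (val A \subset H) && (val B \subset H) ==> (c A == c B)].

Definition ramsey_prop (a k n : nat) : bool :=
  [forall c : coloring n a, exists H : {set 'I_n},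
    homogeneous c H && (#|H| == k)].

(* Off-diagonal form of Ramsey's theorem, for arbitrary finite ground sets. *)
Lemma ramsey_finset (a k l : nat) :
  exists N, forall (T : finType) (S : {set T}) (c : {set T} -> bool),
    N <= #|S| ->
    exists (H : {set T}) (b : bool),
      [/\ H \subset S, #|H| = (if b then k else l)
        & forall A : {set T}, A \subset H -> #|A| = a -> c A = b].
Proof.
elim: a k l => [|a IHa] k l.
  exists (maxn k l) => T S c; rewrite geq_max => /andP[kS lS].
  have mS : (if c set0 then k else l) <= #|S| by case: ifP.
  have [H HS Hm] : exists2 H : {set T}, H \subset S
      & #|H| = (if c set0 then k else l).
    exists [set x in take (if c set0 then k else l) (enum S)].
      by apply/subsetP => x; rewrite inE => /mem_take; rewrite mem_enum.
    rewrite cardsE (card_uniqP _) ?take_uniq ?enum_uniq //.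
    by rewrite size_takel // -cardE.
  exists H, (c set0); split=> // A _ /eqP; rewrite cards_eq0 => /eqP->.
  by [].
have triv b (T : finType) (S : {set T}) (c : {set T} -> bool) :
    [/\ set0 \subset S, #|@set0 T| = 0
      & forall A : {set T}, A \subset set0 -> #|A| = a.+1 -> c A = b].
  split; rewrite ?sub0set ?cards0 // => A.
  by rewrite subset0 => /eqP->; rewrite cards0.
move: {2}(k + l) (leqnn (k + l)) => s; elim: s k l => [|s IHs] k l kls.
  exists 0 => T S c _; exists set0, true.
  by have [? ? ?] := triv true T S c; case: k kls.
case: k kls => [|k] kls.
  by exists 0 => T S c _; exists set0, true; apply: triv.
case: l kls => [|l] kls.
  by exists 0 => T S c _; exists set0, false; apply: triv.
have [p Hp] := IHs k l.+1 ltac:(by rewrite addnS -ltnS -addSn -addnS).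
have [q Hq] := IHs k.+1 l ltac:(by rewrite -ltnS -addnS).
have [r Hr] := IHa p q; exists r.+1 => T S c rS.
have [x xS] : exists x, x \in S by apply/card_gt0P; apply: leq_trans rS.
have [|H0 [b [H0S H0c H0b]]] := Hr T (S :\ x) (fun A => c (x |: A)).
  by rewrite (cardsD1 x) xS in rS.
have xH0 : x \notin H0.
  by apply/negP => /(subsetP H0S); rewrite !inE eqxx.
have H0S' : H0 \subset S := subset_trans H0S (subD1set S x).
have ext (K : {set T}) : K \subset H0 ->
    (forall A : {set T}, A \subset K -> #|A| = a.+1 -> c A = b) ->
    forall A : {set T}, A \subset x |: K -> #|A| = a.+1 -> c A = b.
  move=> KH0 KA A AK Aa; case: (boolP (x \in A)) => xA; last first.
    apply: KA Aa; apply/subsetP => y yA.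
    have := subsetP AK y yA; rewrite !inE => /orP[/eqP yx|//].
    by rewrite -yx yA in xA.
  rewrite -(setD1K xA); apply: H0b.
    by apply: subset_trans KH0; rewrite subDset.
  by move: Aa; rewrite (cardsD1 x) xA => -[].
have xsub (K : {set T}) : K \subset H0 -> x |: K \subset S.
  by move=> KH0; rewrite subUset sub1set xS (subset_trans KH0).
have xcard (K : {set T}) : K \subset H0 -> #|x |: K| = #|K|.+1.
  move=> KH0; rewrite cardsU1; case: (boolP (x \in K)) => // xK.
  by rewrite (subsetP KH0 _ xK) in xH0.
case: b H0c {H0b} ext => H0c ext.
  have [|K [[] [KH0 Kc KA]]] := Hp T H0 c; first by rewrite H0c.
    exists (x |: K), true; split; [exact: xsub | by rewrite xcard ?Kc |].
    exact: ext.
  by exists K, false; split=> //; apply: subset_trans H0S'.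
have [|K [[] [KH0 Kc KA]]] := Hq T H0 c; first by rewrite H0c.
  by exists K, true; split=> //; apply: subset_trans H0S'.
exists (x |: K), false; split; [exact: xsub | by rewrite xcard ?Kc |].
exact: ext.
Qed.

Lemma ramsey_exists (a k : nat) : exists n, ramsey_prop a k n.
Proof.
have [n Hn] := ramsey_finset a k k; exists n.
apply/forallP => c.
have [|H [b [_ Hk Hb]]] := Hn _ [set: 'I_n]
  (fun A => if insub A is Some u then c u else false).
  by rewrite cardsT card_ord.
apply/existsP; exists H; rewrite Hk if_same eqxx andbT.
apply/forallP => A; apply/forallP => B; apply/implyP => /andP[AH BH].
have := Hb _ AH (eqP (valP A)); have := Hb _ BH (eqP (valP B)).
by rewrite !valK => -> ->.
Qed.

Definition R (a k : nat) : nat := ex_minn (ramsey_exists a k).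

(* Main.v *)
(* Put M := R(a-2, k-1) and b := a-2.  Vertices v are taken one after the other
   from a shrinking reservoir S and inserted in an Erdos-Rado tree.  The colors
   c(B + v + y), for y in S and B a b-subset of the path from the root, drive
   the descent of v; the reservoir is then cut down to the most frequent
   outcome, which costs a factor equal to the number of positions in a tree of
   bounded depth.  Since the tree has few positions, S survives until some path
   has M vertices.  Along this path, followed by any remaining y in S, the color
   of an a-subset depends only on its first a-2 elements, and the definition of
   M gives k-1 vertices of the path which together with y form a homogeneous
   set.  Pigeonholing once per insertion over whole positions, instead of once
   per queried color, is affordable within the stated bound. *)

Require Import Defs.
From mathcomp Require Import all_boot zify.
Set Implicit Arguments.
Unset Strict Implicit.
Unset Printing Implicit Defensive.

(** * Counting: binomials and a pigeonhole principle *)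

Lemma leq_bin_expn (n m : nat) : 'C(n, m) <= n ^ m.
Proof.
elim: n m => [|n IHn] [|m]; rewrite ?bin0 ?bin0n // binS.
apply: leq_trans (leq_add (IHn m.+1) (IHn m)) _.
rewrite expnS addnC -mulSn expnS leq_mul2l /=.
by case: m => // m; rewrite leq_exp2r.
Qed.

(** If every fiber had fewer than [2 ^ (m * e)] points, [S] would have at most
    [2 ^ (m.+1 * e) - 2 ^ e]. The successor on [#|S|] pays for the vertex removed before each
    use. *)
Lemma pigeonhole_fiber (T A : finType) (g : T -> A) (S : {set T}) (e m : nat) :
  #|A| <= 2 ^ e -> 0 < e -> 2 ^ (m.+1 * e) <= #|S|.+1 ->
  exists a, 2 ^ (m * e) <= #|[set y in S | g y == a]|.
Proof.
move=> Ae e0 Se; apply/existsP; apply: contraLR Se.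
rewrite negb_exists -ltnNge => /forallP small.
have -> : #|S| = \sum_(a : A) #|[set y in S | g y == a]|.
  rewrite -sum1_card (partition_big g predT) //=.
  by apply: eq_bigr => a _; rewrite sum1dep_card.
have sumS : \sum_(a : A) #|[set y in S | g y == a]| + #|A| <= #|A| * 2 ^ (m * e).
  rewrite -[X in _ + X]sum1_card -big_split /= -sum_nat_const.
  by apply: leq_sum => a _; rewrite addn1 ltnNge small.
have e2 : 2 <= 2 ^ e by rewrite -[2]/(2 ^ 1) leq_exp2l.
have m1 : 0 < 2 ^ (m * e) by rewrite expn_gt0.
have := leq_mul Ae (leqnn (2 ^ (m * e) - 1)); rewrite mulSn expnD.
move: sumS e2 m1; generalize (\sum_(a : A) #|[set y in S | g y == a]|).
move: (2 ^ (m * e)) (2 ^ e) #|A| => x E c s; nia.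
Qed.

(** * Combinations along a path *)

(* Paths are listed from the most recent vertex to the root, so that extending a
   path by [cons] only appends to the list of its [b]-combinations. *)
Fixpoint combs (T : Type) (b : nat) (P : seq T) : seq (seq T) :=
  match b, P with
  | 0, _ => [:: [::]]
  | _, [::] => [::]
  | b'.+1, u :: P' => combs b P' ++ [seq u :: B | B <- combs b' P']
  end.

Lemma size_combs (T : Type) (b : nat) (P : seq T) :
  size (combs b P) = 'C(size P, b).
Proof.
elim: P b => [|u P IHP] [|b] //=.
by rewrite size_cat size_map !IHP binS.
Qed.

Lemma mem_combs (T : eqType) (B P : seq T) :
  subseq B P -> B \in combs (size B) P.
Proof.
elim: P B => [|u P IHP] [|x B] //.
rewrite [subseq _ _]/= [combs _ _]/= mem_cat; case: eqP => [->|_] sBP.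
  by rewrite (map_f (cons u) (IHP _ sBP)) orbT.
by rewrite (IHP (x :: B) sBP).
Qed.

Lemma prefix_combs (T : eqType) (b : nat) (Q P : seq T) :
  prefix (combs b P) (combs b (Q ++ P)).
Proof.
case: b => [|b]; first by case: P; case: Q.
elim: Q => [|u Q IHQ]; first exact: prefix_refl.
by rewrite /= prefix_catl.
Qed.

Lemma subseq_cons2 (T : eqType) (x v : T) (B L : seq T) :
  subseq (x :: v :: B) L ->
  exists Q P, [/\ L = Q ++ v :: P, x \in Q & subseq B P].
Proof.
have cons1 (L' : seq T) : subseq (v :: B) L' ->
    exists Q P, L' = Q ++ v :: P /\ subseq B P.
  elim: L' => [|u L' IHL] //=; case: eqP => [<- sB|_ /IHL[Q [P [-> sB]]]].
    by exists [::], L'.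
  by exists (u :: Q), P.
elim: L => [|u L IHL] //; rewrite [subseq _ _]/=.
case: eqP => [<- /cons1[Q [P [-> sB]]]|_ /IHL[Q [P [-> xQ sB]]]].
  by exists (x :: Q), P; split=> //; rewrite mem_head.
by exists (u :: Q), P; split=> //; rewrite inE xQ orbT.
Qed.

Definition code (T : Type) (f : seq T -> bool) (b : nat) (P : seq T) (v y : T)
  : bitseq := [seq f [:: y, v & B] | B <- combs b P].

Lemma size_code (T : Type) (f : seq T -> bool) (b : nat) (P : seq T) (v y : T) :
  size (code f b P v y) = 'C(size P, b).
Proof. by rewrite size_map size_combs. Qed.

(** * The tree and its invariant *)

(* A node is a pair of a path and of the colors [l] known for the sets [B + v],
   [v] being the vertex of the node; labels grow along paths, so that the depth
   and the label determine the node ([tree_inj]).  [S] is the reservoir. *)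
Record tree_inv (T : finType) (f : seq T -> bool) (b : nat)
    (D : seq (seq T * bitseq)) (S : {set T}) : Prop := TreeInv {
  tree_root : ([::], [::]) \in D;
  tree_size : forall P l, (P, l) \in D -> size l = 'C((size P).-1, b);
  tree_parent : forall v P l, (v :: P, l) \in D ->
    exists2 l0, (P, l0) \in D & prefix l0 l;
  tree_code : forall Q v P l x, (Q ++ v :: P, l) \in D ->
    (x \in Q) || (x \in S) -> prefix (code f b P v x) l;
  tree_inj : forall Q Q' l, (Q, l) \in D -> (Q', l) \in D ->
    size Q = size Q' -> Q = Q';
  tree_fresh : forall Q l, (Q, l) \in D ->
    uniq Q && all (fun x => x \notin S) Q
}.

Lemma prefix_size_inj (T : eqType) (s t u : seq T) :
  prefix s u -> prefix t u -> size s = size t -> s = t.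
Proof. by rewrite !prefixE => /eqP + /eqP + st; rewrite st => -> ->. Qed.

(** Equal depths give labels of equal length, and prefixes of one word that have equal length
    coincide. *)
Lemma tree_prefix_inj (T : finType) f b D (S : {set T}) P P' l l' u :
  tree_inv f b D S -> (P, l) \in D -> (P', l') \in D -> size P = size P' ->
  prefix l u -> prefix l' u -> P = P'.
Proof.
move=> I PD P'D sP pl pl'; have ll' : l = l'.
  by apply: prefix_size_inj pl pl' _; rewrite (tree_size I PD) (tree_size I P'D) sP.
by apply: (tree_inj I PD) sP; rewrite ll'.
Qed.

(* Maximality of [P] in the last hypothesis says that the position of the new
   node is unoccupied. *)
Lemma tree_insert (T : finType) f b D (S S' : {set T}) P l0 l v :
  0 < b -> tree_inv f b D S -> v \in S -> S' \subset S :\ v ->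
  (P, l0) \in D -> prefix l0 l -> size l = 'C(size P, b) ->
  {in S', forall y, code f b P v y = l} ->
  (forall v', (v' :: P, l) \notin D) ->
  tree_inv f b ((v :: P, l) :: D) S'.
Proof.
move=> b0 I vS S'S PD pl0 sl codel free.
have subS x : x \in S' -> x \in S by move/(subsetP S'S); rewrite inE => /andP[].
have vS' : v \notin S' by apply/negP => /(subsetP S'S); rewrite !inE eqxx.
(* A node labelled [l] at the new depth has a parent at the depth of [P] whose label is also a
   prefix of [l]; this parent is [P], against [free]. *)
have freeQ Q : (Q, l) \in D -> size Q <> (size P).+1.
  case: Q => [|v' P'] // QD [sP]; have [l1 P'D pl1] := tree_parent I QD.
  have PP' := tree_prefix_inj I P'D PD sP pl1 pl0.
  by have := free v'; rewrite -PP' QD.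
split.
- by rewrite inE (tree_root I) orbT.
- move=> Q m; rewrite inE => /orP[/eqP[-> ->] //|]; exact: (tree_size I).
- move=> w Q m; rewrite inE => /orP[/eqP[_ -> ->]|QD].
    by exists l0; rewrite ?inE ?PD ?orbT.
  by have [m0 H1 H2] := tree_parent I QD; exists m0; rewrite ?inE ?H1 ?orbT.
- move=> Q w Q' m x; rewrite inE => /orP[/eqP[]|QD xQ]; last first.
    by apply: (tree_code I QD); case/orP: xQ => [->|/subS ->]; rewrite ?orbT.
  case: Q => [[-> -> ->] /codel ->|z Q [-> PE ->]]; first exact: prefix_refl.
  (* Here [w] lies on [P], and [x = v] is covered because [v] was still in the reservoir [S]. *)
  rewrite inE -orbA => xQ; apply: prefix_trans pl0.
  rewrite -PE in PD; apply: (tree_code I PD).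
  by case/or3P: xQ => [/eqP->|->|/subS->]; rewrite ?vS ?orbT.
- move=> Q Q' m; rewrite !inE => /orP[/eqP[-> ->]|QD] /orP[/eqP[->]|Q'D] //.
  + by move=> sQ; case: (freeQ _ Q'D); rewrite -sQ.
  + by move=> ml sQ; rewrite ml in QD; case: (freeQ _ QD).
  + exact: (tree_inj I QD Q'D).
- move=> Q m; rewrite inE => /orP[/eqP[-> _]|QD].
    have /andP[uP aP] := tree_fresh I PD.
    rewrite /= vS' uP andbT /=; apply/andP; split.
      by apply: contraL vS => vP; apply: (allP aP).
    by apply/allP => x /(allP aP); apply: contra => /subS.
  have /andP[-> /allP aQ] := tree_fresh I QD.
  by apply/allP => x /aQ; apply: contra => /subS.
Qed.

(** The root matches, its label being empty; take a matching node of greatest depth. *)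
Lemma tree_position (T : finType) f b D (S : {set T}) (v y : T) :
  tree_inv f b D S ->
  exists p, [&& p \in D, prefix p.2 (code f b p.1 v y)
    & all (fun q => (size q.1 == (size p.1).+1) ==>
                     ~~ prefix q.2 (code f b q.1 v y)) D].
Proof.
move=> I.
pose C (n : nat) := has (fun p => prefix p.2 (code f b p.1 v y) && (size p.1 == n)) D.
have C0 : exists n, C n.
  by exists 0; apply/hasP; exists ([::], [::]); rewrite ?prefix0s // (tree_root I).
have Cub n : C n -> n <= \max_(p <- D) size p.1.
  case/hasP => p pD /andP[_ /eqP <-].
  by rewrite (big_rem p) //= leq_maxl.
have [n /hasP[p pD /andP[pp /eqP pn]] nmax] := ex_maxnP C0 Cub.
exists p; rewrite pD pp /=; apply/allP => q qD; apply/implyP => /eqP sq.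
apply/negP => pq; have : C (size q.1) by apply/hasP; exists q; rewrite ?pq /=.
by move/nmax; rewrite sq pn ltnn.
Qed.

(** * Growing the tree by pigeonhole on positions *)

(** Padding labels with [false] makes positions a finite type; nothing is lost once the depth fixes
    the length of the label. *)
Definition pad (M K : nat) (s : nat) (l : bitseq) : 'I_M.+1 * K.-tuple bool :=
  (inord s, [tuple nth false l i | i < K]).

Lemma pad_inj (M K s s' : nat) (l l' : bitseq) :
  s <= M -> s' <= M -> pad M K s l = pad M K s' l' -> size l <= K ->
  (s = s' -> size l = size l') -> s = s' /\ l = l'.
Proof.
move=> sM s'M /pair_equal_spec[/(congr1 val) /=].
rewrite !inordK // => -> ll' lK /(_ erefl) sl; split=> //.
apply: (eq_from_nth (x0 := false)) => // i il.
have := congr1 (fun t => tnth t (Ordinal (leq_trans il lK))) ll'.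
by rewrite !tnth_mktuple.
Qed.

Lemma card_pad (M K : nat) : #|{: 'I_M.+1 * K.-tuple bool}| = M.+1 * 2 ^ K.
Proof. by rewrite card_prod card_ord card_tuple card_bool. Qed.

Lemma prefix_code (T : eqType) (f : seq T -> bool) b (Q P : seq T) v y :
  prefix (code f b P v y) (code f b (Q ++ P) v y).
Proof.
have /prefixP[s QP] := prefix_combs b Q P.
by rewrite /code QP map_cat prefix_prefix.
Qed.

Lemma tree_step (T : finType) f b D (S : {set T}) M e m :
  0 < b -> 0 < e -> M.+1 * 2 ^ 'C(M, b) <= 2 ^ e ->
  tree_inv f b D S -> {in D, forall p, size p.1 <= M} ->
  2 ^ (m.+1 * e) <= #|S| ->
  exists p (S' : {set T}), [/\ tree_inv f b (p :: D) S', p \notin D,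
    size p.1 <= M.+1 & 2 ^ (m * e) <= #|S'|].
Proof.
move=> b0 e0 Ae I DM Se.
have /card_gt0P[v vS] : 0 < #|S| by apply: leq_trans Se; rewrite expn_gt0.
pose good y (p : seq T * bitseq) := prefix p.2 (code f b p.1 v y)
    && all (fun q => (size q.1 == (size p.1).+1) ==>
                     ~~ prefix q.2 (code f b q.1 v y)) D.
pose pos y := nth ([::], [::]) D (find (good y) D).
have hasg y : has (good y) D.
  have [p /andP[pD gp]] := tree_position v y I.
  by apply/hasP; exists p.
have posD y : pos y \in D by rewrite mem_nth // -has_find hasg.
have posP y : good y (pos y) := nth_find _ (hasg y).
(* Depth and code suffice to recover the node, whose label is a prefix of the code. *)
pose g y := pad M 'C(M, b) (size (pos y).1) (code f b (pos y).1 v y).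
have [||alpha S'm] := @pigeonhole_fiber _ _ g (S :\ v) e m _ e0.
- by rewrite card_pad.
- by rewrite (cardsD1 v) vS in Se.
set S' := [set y in S :\ v | g y == alpha] in S'm.
have /card_gt0P[y0 y0S] : 0 < #|S'| by apply: leq_trans S'm; rewrite expn_gt0.
have S'S : S' \subset S :\ v by apply/subsetP => y; rewrite inE => /andP[].
have := posP y0; have := posD y0; case E0 : (pos y0) => [P l0] PD /andP[/= pl0 free0].
set l := code f b P v y0 in pl0.
(* Codes grow with the path, so such a node would match [y0] one level deeper. *)
have lfree v' : (v' :: P, l) \notin D.
  apply: contraTN isT => v'D; have := allP free0 _ v'D.
  by rewrite /= eqxx /= (prefix_code _ _ [:: v']).
exists (v :: P, l), S'; split=> //; last by apply: DM PD.
apply: (tree_insert b0 I vS S'S PD pl0); rewrite ?size_code // => y yS.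
have : g y = g y0.
  by move: yS y0S; rewrite !inE => /andP[_ /eqP ->] /andP[_ /eqP ->].
rewrite /g E0 /=; have := posP y; have := posD y.
case Ey : (pos y) => [Py ly] PyD /andP[/= ply _] /pad_inj[||||sP lP] //.
- exact: DM PyD.
- exact: DM PD.
- by rewrite size_code leq_bin2l // (DM _ PyD).
- by rewrite !size_code => ->.
rewrite lP in ply; rewrite -/l in lP ply.
by rewrite -(tree_prefix_inj I PyD PD sP ply pl0).
Qed.

Lemma size_tree (T : finType) f b D (S : {set T}) M :
  tree_inv f b D S -> uniq D -> {in D, forall p, size p.1 <= M} ->
  size D <= M.+1 * 2 ^ 'C(M, b).
Proof.
move=> I uD DM; pose g (p : seq T * bitseq) := pad M 'C(M, b) (size p.1) p.2.
have ginj : {in D &, injective g}.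
  move=> [P l] [P' l'] PD P'D /pad_inj[||||/= sP ll'].
  - exact: DM PD.
  - exact: DM P'D.
  - rewrite (tree_size I PD) leq_bin2l // (leq_trans (leq_pred _)) //.
    exact: DM PD.
  - by rewrite /= (tree_size I PD) (tree_size I P'D) => ->.
  by rewrite -ll' in P'D *; rewrite (tree_inj I PD P'D sP).
rewrite -card_pad -(size_map g); rewrite -(map_inj_in_uniq ginj) in uD.
by rewrite -(card_uniqP uD) max_card.
Qed.

(** Each step adds a node and spends one unit of [m], so [size D + m] is constant. The tree of depth
    [M] has bounded size, so a deeper node appears before [m] runs out. *)
Lemma tree_long_path (T : finType) f b D (S : {set T}) M e m :
  0 < b -> 0 < e -> M.+1 * 2 ^ 'C(M, b) <= 2 ^ e ->
  tree_inv f b D S -> uniq D -> {in D, forall p, size p.1 <= M} ->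
  M.+1 * 2 ^ 'C(M, b) < size D + m -> 2 ^ (m * e) <= #|S| ->
  exists D' (S' : {set T}) Q l y, [/\ tree_inv f b D' S', (Q, l) \in D',
    size Q = M.+1 & y \in S'].
Proof.
move=> b0 e0 Ae; elim: m D S => [|m IHm] D S I uD DM.
  by rewrite addn0 ltnNge (size_tree I uD DM).
move=> Dm Sm; have [[Q l] [S' [I' pD pM S'm]]] := tree_step b0 e0 Ae I DM Sm.
move: pM; rewrite leq_eqVlt => /orP[/eqP pM|pM].
  have /card_gt0P[y yS] : 0 < #|S'| by apply: leq_trans S'm; rewrite expn_gt0.
  by exists ((Q, l) :: D), S', Q, l, y; rewrite mem_head.
apply: (IHm _ S' I') => //=.
- by rewrite pD.
- by move=> q; rewrite inE => /orP[/eqP->|/DM].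
- by rewrite addSnnS.
Qed.

Lemma end_homogeneous_path (T : finType) (f : seq T -> bool) b M e :
  0 < b -> 0 < e -> M.+1 * 2 ^ 'C(M, b) <= 2 ^ e ->
  2 ^ (M.+1 * 2 ^ 'C(M, b) * e) <= #|T| ->
  exists (Q : seq T) (y : T) (d : seq T -> bool),
    [/\ size Q = M.+1, uniq (y :: Q) & forall x v B,
      subseq [:: x, v & B] (y :: Q) -> size B = b -> f [:: x, v & B] = d B].
Proof.
move=> b0 e0 Ae eT.
have I0 : tree_inv f b [:: ([::], [::])] [set: T].
  split=> [|P l|v P l|Q v P l x|Q Q' l|Q l]; rewrite ?inE //.
  - by case/eqP => -> ->; rewrite /= bin0n; case: (b) b0.
  - by case: Q.
  - by move=> /eqP[-> _] /eqP[->].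
  - by case/eqP => -> _.
(* The root already counts as one node, so this [m] just exceeds the capacity. *)
have [||||D [S [Q [l [y [I QD sQ yS]]]]]] :=
  tree_long_path (m := M.+1 * 2 ^ 'C(M, b)) b0 e0 Ae I0 => //.
- by move=> p; rewrite inE => /eqP->.
- by rewrite cardsT.
exists Q, y, (fun B => nth false l (index B (combs b Q))).
have /andP[uQ /allP aQ] := tree_fresh I QD.
split=> // [|x v B /subseq_cons2[Q1 [P [yQ xQ1 sB]]] sizeB].
  by rewrite /= uQ andbT; apply: contraL yS => /aQ.
case: Q1 yQ xQ1 => // z Q1 [<- QE] xQ1; rewrite QE in QD.
have : prefix (code f b P v x) l.
  apply: (tree_code I QD); move: xQ1; rewrite inE => /orP[/eqP->|->] //.
  by rewrite yS orbT.
have BP : B \in combs b P by rewrite -sizeB mem_combs.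
have iB : index B (combs b P) < size (combs b P) by rewrite index_mem.
(* The combinations of [P] begin those of [Q], so [B] has the same index in both lists. *)
have /prefixP[s Qs] := prefix_combs b (rcons Q1 v) P.
case/prefixP => s' ->; rewrite QE -cat_rcons Qs index_cat BP nth_cat size_map iB.
by rewrite (nth_map [::]) // nth_index.
Qed.

(** * From the path to the bound *)

(** The [b]-subsets of [Q] are colored by [d]. The vertex [y] is the most recent one, hence among
    the two that [d] ignores, and can join the homogeneous set. *)
Lemma homogeneous_extend (T : finType) (col : {set T} -> bool) (d : seq T -> bool)
    (Q : seq T) (y : T) b j :
  ramsey_prop b j (size Q) -> uniq (y :: Q) ->
  (forall x v B, subseq [:: x, v & B] (y :: Q) -> size B = b ->
     col [set z in [:: x, v & B]] = d B) ->
  exists (H : {set T}) (e : bool), #|H| = j.+1 /\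
    forall A : {set T}, A \subset H -> #|A| = b.+2 -> col A = e.
Proof.
move=> rQ uyQ dE; have /andP[yQ uQ] : (y \notin Q) && uniq Q by [].
pose q (i : 'I_(size Q)) := tnth (in_tuple Q) i.
have qinj : injective q by apply/tuple_uniqP.
have qQ i : q i \in Q := mem_tnth i (in_tuple Q).
have qP z : z \in Q -> exists i, z = q i by move=> /(tnthP (in_tuple Q)).
pose word (X : {set 'I_(size Q)}) := [seq z <- Q | z \in q @: X].
pose c' : coloring (size Q) b := [ffun X : subsets (size Q) b => d (word (val X))].
have /existsP[X0 /andP[homX0 /eqP cX0]] := forallP rQ c'.
(* The common color, or [false] when [X0] has no [b]-subset. *)
pose e := [exists X : subsets (size Q) b, (val X \subset X0) && c' X].
have c'e (X : subsets (size Q) b) : val X \subset X0 -> c' X = e.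
  move=> XX0; rewrite /e; case: existsP => [[Y /andP[YX0 <-]]|nY].
    have /forallP/(_ X)/forallP/(_ Y) := homX0.
    by rewrite XX0 YX0 => /eqP.
  by apply/negbTE/negP => cX; case: nY; exists X; rewrite XX0.
exists (y |: q @: X0), e; split.
  rewrite cardsU1 card_imset // cX0 -[RHS]add1n; congr (_ + _).
  by rewrite (contraNN _ yQ) // => /imsetP[i _ ->].
move=> A AH cA; pose L := [seq z <- y :: Q | z \in A].
have LA : [set z in L] = A.
  apply/setP => z; rewrite inE mem_filter; case: (boolP (z \in A)) => //= zA.
  have := subsetP AH z zA; rewrite !inE => /orP[->//|/imsetP[i _ ->]].
  by rewrite qQ orbT.
have sL : size L = b.+2.
  by rewrite -cA -LA cardsE; apply/esym/card_uniqP; apply: filter_uniq.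
have sub : subseq L (y :: Q) := filter_subseq _ _.
have LinA z : z \in L -> z \in A by rewrite mem_filter => /andP[].
case: L LA sL sub LinA => [|x [|v B]] // LA [sB] sub LinA.
rewrite -LA (dE _ _ _ sub sB).
have sBQ : subseq B Q.
  have [Q1 [P [yQE xQ1 BP]]] := subseq_cons2 sub.
  case: Q1 yQE xQ1 => // z Q1 [_ ->] _.
  by rewrite (subseq_trans BP) // -cat_rcons suffix_subseq.
pose X := [set i | q i \in B].
have qX : q @: X = [set z in B].
  apply/setP => z; rewrite inE; apply/imsetP/idP => [[i + ->]|zB].
    by rewrite inE.
  by have [i zi] := qP z (mem_subseq sBQ zB); exists i; rewrite // inE -zi.
have cX : #|X| == b.
  rewrite -(card_imset X qinj) qX cardsE (card_uniqP _) ?sB //.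
  exact: subseq_uniq sBQ uQ.
have XX0 : X \subset X0.
  apply/subsetP => i; rewrite inE => iB.
  have : q i \in y |: q @: X0 by rewrite (subsetP AH) // LinA // !inE iB !orbT.
  rewrite !inE => /orP[/eqP iy|]; first by rewrite -iy qQ in yQ.
  by rewrite mem_imset.
rewrite -(c'e (exist _ X cX)) // ffunE /word /= qX; congr d.
rewrite [LHS](subseq_uniqP uQ sBQ).
by apply: eq_filter => z; rewrite inE.
Qed.

(** Both [M] and ['C(M, b)] are at most [M.+1 ^ b]; the resulting factor 2 is absorbed because the
    second inequality is strict. *)
Lemma exponent_bound (M b : nat) : 0 < b ->
  M.+1 * 2 ^ 'C(M, b) * (M + 'C(M, b)) <= M.+1 ^ b.+1 * 2 ^ (M.+1 ^ b).
Proof.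
move=> b0; have cM : 'C(M, b) < M.+1 ^ b.
  by apply: leq_ltn_trans (leq_bin_expn M b) _; rewrite ltn_exp2r.
have Mb : M <= M.+1 ^ b.
  by apply: ltnW; rewrite -{1}[M.+1]expn1 leq_pexp2l.
rewrite expnS -!mulnA leq_mul2l /= mulnC.
apply: (@leq_trans (2 * M.+1 ^ b * 2 ^ 'C(M, b))).
  by rewrite leq_mul2r mul2n -addnn leq_add ?orbT // ltnW.
rewrite -mulnA mulnCA leq_mul2l -expnS leq_exp2l //.
by rewrite cM orbT.
Qed.

Theorem theoremA2 (a k : nat) (ha : 3 <= a) (hk : 3 <= k) :
  R a k <=
    2 ^ (R (a - 2) (k - 1) ^ (a - 1) * 2 ^ (R (a - 2) (k - 1) ^ (a - 2))).
Proof.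
case: a ha => [|[|b]] // b0; case: k hk => [|j] // j2.
rewrite !ltnS in b0 j2; rewrite !subSS !subn0.
have : ramsey_prop b j (R b j) by rewrite /R; case: ex_minnP.
move: (R b j) => M rM; have jM : j <= M.
  have /existsP[H /andP[_ /eqP <-]] := forallP rM [ffun _ => true].
  by rewrite -[M in _ <= M]card_ord max_card.
(* From here the Ramsey number is [M.+1], the length wanted for the path. *)
have := leq_trans j2 jM; case: M rM {jM} => [|M] // rM; rewrite ltnS => M0.
set N := 2 ^ _; rewrite {1}/R; case: ex_minnP => n _; apply.
apply/forallP => c; pose col A := if insub A is Some u then c u else false.
(* The exponent [M + 'C(M, b)] works since [M < 2 ^ M]. *)
have [|||Q [y [d [sQ uyQ dE]]]] :=
  @end_homogeneous_path 'I_N (fun L => col [set z in L]) b M (M + 'C(M, b)) b0.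
- by rewrite addn_gt0 M0.
- by rewrite expnD leq_mul2r ltn_expl // orbT.
- by rewrite card_ord leq_exp2l // exponent_bound.
rewrite -sQ in rM; have [H [e [cH He]]] := homogeneous_extend rM uyQ dE.
apply/existsP; exists H; rewrite cH eqxx andbT.
apply/forallP => A; apply/forallP => B; apply/implyP => /andP[AH BH].
have := He _ AH (eqP (valP A)); have := He _ BH (eqP (valP B)).
by rewrite /col !valK => -> ->.
Qed.
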